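(* For each computable function $f\colon\mathbb{Z}^+\to\mathbb{Z}^+$ satisfying $f(n)=\omega(1)$, the problem Metric $1$-median has a deterministic, nonadaptive algorithm that makes $o(n)$ queries and is $g(n)$-approximate for some function $g(n)=o(f(n)\cdot\log n)$.
   Context: Metric $1$-median: given an $n$-point metric space $(M,d)$ (the point set $M$ is known to the algorithm, while $d$ is accessible only through queries, each query asking for $d(x,y)$ for some $x,y\in M$), output a point $p\in M$. An algorithm is $\gamma(n)$-approximate if on every $n$-point metric space its output $p$ satisfies $\sum_{y\in M}d(p,y)\le\gamma(n)\min_{q\in M}\sum_{y\in M}d(q,y)$. The query complexity is the worst-case number of queries on $n$-point inputs. An algorithm is nonadaptive if, for each $i>1$, its $i$th query $(x_i,y_i)\in M^2$ does not depend on the answers to the first $i-1$ queries. *)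

(* Defs.v *)
From HB Require Import structures.
From mathcomp Require Import all_boot all_order all_algebra.
From mathcomp Require Import all_classical all_reals all_analysis.
Set Implicit Arguments.
Unset Strict Implicit.
Unset Printing Implicit Defensive.
Import Order.TTheory GRing.Theory Num.Theory.
Import numFieldNormedType.Exports.
Local Open Scope ring_scope.

(** * Computable functions on natural numbers: WHILE programs *)

Inductive nexp : Type :=
  | NVar of nat
  | NConst of nat
  | NAdd of nexp & nexp
  | NSub of nexp & nexp (* truncated *)
  | NMul of nexp & nexp
  | NDiv of nexp & nexp (* quotient, with value 0 when dividing by 0 *).

Fixpoint neval (s : nat -> nat) (e : nexp) : nat :=
  match e with
  | NVar x => s x
  | NConst k => k
  | NAdd e1 e2 => (neval s e1 + neval s e2)%N
  | NSub e1 e2 => (neval s e1 - neval s e2)%N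
  | NMul e1 e2 => (neval s e1 * neval s e2)%N
  | NDiv e1 e2 => (neval s e1 %/ neval s e2)%N
  end.

(* Tests of conditionals and loops succeed when the expression is nonzero. *)
Inductive nprog : Type :=
  | NSkip
  | NAssign of nat & nexp
  | NSeq of nprog & nprog
  | NIf of nexp & nprog & nprog
  | NWhile of nexp & nprog.

Definition update (T : Type) (s : nat -> T) (x : nat) (v : T) : nat -> T :=
  fun y => if y == x then v else s y.

Inductive nexec : nprog -> (nat -> nat) -> (nat -> nat) -> Prop :=
  | nexec_skip s : nexec NSkip s s
  | nexec_assign s x e : nexec (NAssign x e) s (update s x (neval s e))
  | nexec_seq c1 c2 s1 s2 s3 :
      nexec c1 s1 s2 -> nexec c2 s2 s3 -> nexec (NSeq c1 c2) s1 s3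
  | nexec_if_true e c1 c2 s s' :
      neval s e <> 0%N -> nexec c1 s s' -> nexec (NIf e c1 c2) s s'
  | nexec_if_false e c1 c2 s s' :
      neval s e = 0%N -> nexec c2 s s' -> nexec (NIf e c1 c2) s s'
  | nexec_while_true e c s1 s2 s3 :
      neval s1 e <> 0%N -> nexec c s1 s2 -> nexec (NWhile e c) s2 s3 ->
      nexec (NWhile e c) s1 s3
  | nexec_while_false e c s :
      neval s e = 0%N -> nexec (NWhile e c) s s.

(* The input is in register 0 and all other registers are 0. *)
Definition input (n : nat) : nat -> nat := update (fun=> 0%N) 0%N n.

(* Functions on the positive integers are functions on [nat] whose value at 0
   is irrelevant. *)
Definition computable (f : nat -> nat) : Prop :=
  exists c : nprog, forall n, (0 < n)%N ->
    exists2 s, nexec c (input n) s & s 0%N = f n.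

(** * Algorithms: WHILE programs on a real RAM with a distance oracle

   A state consists of the natural-number registers together with an infinite
   array of reals addressed by natural-number expressions. There are no real
   constants besides natural numbers and no rounding, so that the only access
   to the distances is by queries, exact field operations and comparisons. *)

Inductive arith : Type := AAdd | ASub | AMul | ADiv.

Definition arith_op (R : realType) (o : arith) : R -> R -> R :=
  match o with
  | AAdd => fun x y => x + y
  | ASub => fun x y => x - y
  | AMul => fun x y => x * y
  | ADiv => fun x y => x / y
  end.

Inductive prog : Type :=
  | PNat of nprog
  | PSeq of prog & prog
  | PIf of nexp & prog & prog
  | PWhile of nexp & prog
  | PLoad of nexp & nexp                 (* mem[a] := e *)
  | PArith of arith & nexp & nexp & nexp (* mem[a] := mem[b] o mem[c] *)
  | PCompare of nat & nexp & nexp        (* x := (mem[a] <= mem[b]) *)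
  | PQuery of nexp & nexp & nexp         (* mem[a] := d(u, v) *).

(* [exec d c s m t s' m']: from registers [s] and array [m], the program [c]
   halts with registers [s'] and array [m'], having made the queries [t] in
   this order. Querying a label which is not below [n] blocks the execution. *)
Inductive exec (R : realType) (n : nat) (d : 'I_n -> 'I_n -> R) :
    prog -> (nat -> nat) -> (nat -> R) -> seq ('I_n * 'I_n) ->
    (nat -> nat) -> (nat -> R) -> Prop :=
  | exec_nat c s s' m : nexec c s s' -> exec d (PNat c) s m [::] s' m
  | exec_seq c1 c2 s1 m1 t1 s2 m2 t2 s3 m3 :
      exec d c1 s1 m1 t1 s2 m2 -> exec d c2 s2 m2 t2 s3 m3 ->
      exec d (PSeq c1 c2) s1 m1 (t1 ++ t2) s3 m3
  | exec_if_true e c1 c2 s m t s' m' :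
      neval s e <> 0%N -> exec d c1 s m t s' m' ->
      exec d (PIf e c1 c2) s m t s' m'
  | exec_if_false e c1 c2 s m t s' m' :
      neval s e = 0%N -> exec d c2 s m t s' m' ->
      exec d (PIf e c1 c2) s m t s' m'
  | exec_while_true e c s1 m1 t1 s2 m2 t2 s3 m3 :
      neval s1 e <> 0%N -> exec d c s1 m1 t1 s2 m2 ->
      exec d (PWhile e c) s2 m2 t2 s3 m3 ->
      exec d (PWhile e c) s1 m1 (t1 ++ t2) s3 m3
  | exec_while_false e c s m :
      neval s e = 0%N -> exec d (PWhile e c) s m [::] s m
  | exec_load a e s m :
      exec d (PLoad a e) s m [::] s (update m (neval s a) (neval s e)%:R)
  | exec_arith o a b c s m :
      exec d (PArith o a b c) s m [::] s
        (update m (neval s a) (arith_op o (m (neval s b)) (m (neval s c))))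
  | exec_compare x a b s m :
      exec d (PCompare x a b) s m [::]
        (update s x (m (neval s a) <= m (neval s b))) m
  | exec_query a u v (i j : 'I_n) s m :
      neval s u = i -> neval s v = j ->
      exec d (PQuery a u v) s m [:: (i, j)] s (update m (neval s a) (d i j)).

(** * Metric 1-median *)

Record is_metric (R : realType) (T : Type) (d : T -> T -> R) : Prop := {
  metric_ge0 : forall x y, 0 <= d x y;
  metric_eq0 : forall x y, d x y = 0 <-> x = y;
  metric_sym : forall x y, d x y = d y x;
  metric_triangle : forall x y z, d x z <= d x y + d y z }.

(* Started on [n] with an array of zeros, [A] makes the queries [t] and leaves
   the point [p] in register 0. *)
Definition outputs (R : realType) (A : prog) (n : nat) (d : 'I_n -> 'I_n -> R)
    (t : seq ('I_n * 'I_n)) (p : 'I_n) : Prop :=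
  exists s m, exec d A (input n) (fun=> 0) t s m /\ s 0%N = p.

Definition median_algorithm (R : realType) (A : prog) : Prop :=
  forall n (d : 'I_n -> 'I_n -> R), (0 < n)%N -> is_metric d ->
    exists t p, outputs A d t p.

Definition nonadaptive (R : realType) (A : prog) : Prop :=
  forall n (d d' : 'I_n -> 'I_n -> R) t t' p p',
    is_metric d -> is_metric d' ->
    outputs A d t p -> outputs A d' t' p' -> t = t'.

(* [q n] is the maximal number of queries over all [n]-point inputs. *)
Definition query_complexity (R : realType) (A : prog) (q : nat -> nat) : Prop :=
  forall n, (0 < n)%N ->
    (forall (d : 'I_n -> 'I_n -> R) t p,
        is_metric d -> outputs A d t p -> (size t <= q n)%N) /\
    (exists (d : 'I_n -> 'I_n -> R) t p,
        [/\ is_metric d, outputs A d t p & size t = q n]).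

Definition cost (R : realType) (n : nat) (d : 'I_n -> 'I_n -> R) (p : 'I_n) : R :=
  \sum_y d p y.

(* The base value [cost d p] of the iterated minimum is itself one of the
   costs, so this is the minimum of [cost d] whatever the point [p]. *)
Definition min_cost (R : realType) (n : nat) (d : 'I_n -> 'I_n -> R) (p : 'I_n) : R :=
  \big[Num.min/cost d p]_(q < n) cost d q.

Definition approximate (R : realType) (A : prog) (g : nat -> R) : Prop :=
  forall n (d : 'I_n -> 'I_n -> R) t p, (0 < n)%N ->
    is_metric d -> outputs A d t p -> cost d p <= g n * min_cost d p.

(** * Determinism *)

Lemma nexec_det c s s1 s2 : nexec c s s1 -> nexec c s s2 -> s1 = s2.
Proof.
move=> h; elim: h s2 => {c s s1}.
- by move=> s s2 h; inversion h.
- by move=> s x e s2 h; inversion h.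
- move=> c1 c2 sa sb sc _ IH1 _ IH2 s2 h; inversion h; subst.
  by have ? := IH1 _ ltac:(eassumption); subst; apply: IH2.
- by move=> e c1 c2 s s' ne _ IH s2 h; inversion h; subst => //; apply: IH.
- by move=> e c1 c2 s s' ne _ IH s2 h; inversion h; subst => //; apply: IH.
- move=> e c sa sb sc ne _ IH1 _ IH2 s2 h; inversion h; subst => //.
  by have ? := IH1 _ ltac:(eassumption); subst; apply: IH2.
- by move=> e c s ne s2 h; inversion h; subst.
Qed.

Lemma exec_det (R : realType) n (d : 'I_n -> 'I_n -> R) c s m t1 s1 m1 t2 s2 m2 :
  exec d c s m t1 s1 m1 -> exec d c s m t2 s2 m2 ->
  [/\ t1 = t2, s1 = s2 & m1 = m2].
Proof.
move=> h; elim: h t2 s2 m2 => {c s m t1 s1 m1}.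
- move=> c s s' m hc t2 s2 m2 h; inversion h; subst; split=> //.
  by apply: nexec_det hc _.
- move=> c1 c2 sa ma ta sb mb tb sc mc _ IH1 _ IH2 t2 s2 m2 h.
  inversion h; subst.
  have [? ? ?] := IH1 _ _ _ ltac:(eassumption); subst.
  by have [? ? ?] := IH2 _ _ _ ltac:(eassumption); subst.
- by move=> e c1 c2 s m t s' m' ne _ IH t2 s2 m2 h; inversion h; subst => //;
    apply: IH.
- by move=> e c1 c2 s m t s' m' ne _ IH t2 s2 m2 h; inversion h; subst => //;
    apply: IH.
- move=> e c sa ma ta sb mb tb sc mc ne _ IH1 _ IH2 t2 s2 m2 h.
  inversion h; subst => //.
  have [? ? ?] := IH1 _ _ _ ltac:(eassumption); subst.
  by have [? ? ?] := IH2 _ _ _ ltac:(eassumption); subst.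
- by move=> e c s m ne t2 s2 m2 h; inversion h; subst.
- by move=> a e s m t2 s2 m2 h; inversion h; subst.
- by move=> o a b c s m t2 s2 m2 h; inversion h; subst.
- by move=> x a b s m t2 s2 m2 h; inversion h; subst.
- move=> a u v i j s m hi hj t2 s2 m2 h; inversion h; subst.
  have ei : i0 = i by apply/val_inj; rewrite /= -hi.
  have ej : j0 = j by apply/val_inj; rewrite /= -hj.
  by rewrite ei ej.
Qed.

Lemma outputs_det (R : realType) A n (d : 'I_n -> 'I_n -> R) t1 p1 t2 p2 :
  outputs A d t1 p1 -> outputs A d t2 p2 -> t1 = t2 /\ p1 = p2.
Proof.
move=> [s1 [m1 [h1 e1]]] [s2 [m2 [h2 e2]]].
have [-> es _] := exec_det h1 h2; split=> //.
by apply/val_inj; rewrite /= -e1 -e2 es.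
Qed.

(* Main.v *)
Require Import Defs.
From HB Require Import structures.
From mathcomp Require Import all_boot all_order all_algebra.
From mathcomp Require Import all_classical all_reals all_analysis.
From mathcomp Require Import zify ring lra.
Set Implicit Arguments.
Unset Strict Implicit.
Unset Printing Implicit Defensive.
Import Order.TTheory GRing.Theory Num.Theory.
Import numFieldNormedType.Exports.
Local Open Scope classical_set_scope.
Local Open Scope ring_scope.

(** Let [N = 2 ^ k] be the largest power of two with [N <= n / sqrt (f n)], and
    let [T] be the set of the first [N] points. Query the [2 * N] edges
    of the de Bruijn graph on [T], from [x] to [2x] and [2x + 1] modulo [N], and
    output the point [p] of [T] which minimizes the mean length of a random walk
    of [k] steps. Such a walk from [x] ends at a uniform point of [T], so by the
    triangle inequality this mean is at least the mean distance from [x] to [T].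
    Each vertex of the graph has in-degree 2, so from a uniform starting point
    every step of the walk joins two uniform points, and has mean length at most
    twice the mean distance from [T] to any given [q]. Hence the sum of the
    distances from [p] to [T] is at most [2 * k * cost q], which bounds [d p q]
    by [(2 * k + 1) * cost q / N] and gives the approximation ratio
    [n / N * (2 * k + 1) + 1 = O(sqrt (f n) * log n)]. *)

(** * Walks in the de Bruijn graph *)

(* Mean length of a random walk of [j] steps from [x] in the graph with the
   edges from [x] to [2x] and [2x + 1] modulo [N]. *)
Fixpoint walk (R : realType) (D : nat -> nat -> R) (N j x : nat) : R :=
  if j is j'.+1 then
    (D x ((2 * x) %% N)%N + D x ((2 * x + 1) %% N)%N
     + walk D N j' ((2 * x) %% N)%N + walk D N j' ((2 * x + 1) %% N)%N) / 2%:R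
  else 0.

Lemma sum_double (R : nmodType) (F : nat -> R) N :
  \sum_(0 <= x < N) (F (2 * x)%N + F (2 * x + 1)%N) = \sum_(0 <= z < 2 * N) F z.
Proof.
elim: N => [|N IH]; first by rewrite muln0 !big_geq.
rewrite big_nat_recr //= IH.
have -> : (2 * N.+1 = (2 * N).+2)%N by lia.
by rewrite 2?big_nat_recr //= addrA addn1.
Qed.

(** For [x < N] the numbers [2x] and [2x + 1] run once through [0, ..., 2N - 1], hence modulo [N]
    twice through all residues. This is the in-degree 2 of the graph. *)
Lemma sum_mod_double (R : pzSemiRingType) (F : nat -> R) N :
  \sum_(0 <= x < N) (F ((2 * x) %% N)%N + F ((2 * x + 1) %% N)%N)
  = (\sum_(0 <= x < N) F x) *+ 2.
Proof.
rewrite (sum_double (fun z => F (z %% N)%N)) (@big_cat_nat _ _ _ N) //=; last lia.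
rewrite mulr2n; congr +%R.
  by apply: eq_big_nat => x /andP[_ xN]; rewrite modn_small.
rewrite mul2n -addnn -{1}[N]add0n big_addn addnK.
by apply: eq_big_nat => x /andP[_ xN]; rewrite modnDr modn_small.
Qed.

(** Induction on the first step: [sum_mod_double] returns the rest of the walk to a uniform start,
    so each step adds at most [2 * C], half of the bound [4 * C] on the total length of all
    edges. *)
Lemma sum_walk_le (R : realType) (D : nat -> nat -> R) N q j :
  (forall x y, D x y = D y x) -> (forall x y z, D x z <= D x y + D y z) ->
  \sum_(0 <= x < N) walk D N j x <= (2 * j)%:R * \sum_(0 <= x < N) D q x.
Proof.
move=> Dsym Dtri; elim: j => [|j IH] /=; first by rewrite big1 ?mul0r.
set C := \sum_(0 <= x < N) D q x in IH *.
have -> : \sum_(0 <= x < N)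
    (D x ((2 * x) %% N)%N + D x ((2 * x + 1) %% N)%N
     + walk D N j ((2 * x) %% N)%N + walk D N j ((2 * x + 1) %% N)%N) / 2%:R
   = (\sum_(0 <= x < N) (D x ((2 * x) %% N)%N + D x ((2 * x + 1) %% N)%N)
     + (\sum_(0 <= x < N) walk D N j x) *+ 2) / 2%:R.
  rewrite -(sum_mod_double (walk D N j)) -big_split /= mulr_suml.
  by apply: eq_bigr => x _; rewrite !addrA.
(* Each edge is detoured through [q]; tails and heads both cover every vertex twice. *)
have : \sum_(0 <= x < N) (D x ((2 * x) %% N)%N + D x ((2 * x + 1) %% N)%N)
    <= C *+ 2 + C *+ 2.
  rewrite -{2}(sum_mod_double (D q)) /C -sumrMnl -big_split /=.
  apply: ler_sum => x _.
  have := Dtri x q ((2 * x) %% N)%N; have := Dtri x q ((2 * x + 1) %% N)%N.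
  rewrite (Dsym x q); lra.
have -> : (2 * j.+1)%:R = (2 * j)%:R + 2 :> R by rewrite mulnS addnC natrD.
rewrite mulrDl; lra.
Qed.

(** The [2 ^ j] walks of [j] steps end at [2 ^ j * x + c] modulo [N], the binary digits of [c] being
    the successive choices; each walk is at least as long as the distance between its ends. *)
Lemma walk_ge (R : realType) (D : nat -> nat -> R) N j x :
  (forall x, D x x = 0) -> (forall x y z, D x z <= D x y + D y z) ->
  (x < N)%N ->
  \sum_(0 <= c < 2 ^ j) D x ((2 ^ j * x + c) %% N)%N <= (2 ^ j)%:R * walk D N j x.
Proof.
move=> D0 Dtri; elim: j x => [|j IH] x xN.
  by rewrite expn0 big_nat1 /= mul1n addn0 modn_small // D0 mulr0.
have N0 : (0 < N)%N by apply: leq_ltn_trans xN.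
have half b : \sum_(0 <= c < 2 ^ j) D x ((2 ^ j * (2 * x + b) + c) %% N)%N
    <= (2 ^ j)%:R * (D x ((2 * x + b) %% N)%N + walk D N j ((2 * x + b) %% N)%N).
  rewrite mulrDr; apply: le_trans (lerD (lexx _) (IH _ (ltn_pmod _ N0))).
  have -> : (2 ^ j)%:R * D x ((2 * x + b) %% N)%N
      = \sum_(0 <= c < 2 ^ j) D x ((2 * x + b) %% N)%N.
    by rewrite big_const_nat subn0 iter_addr_0 mulr_natl.
  rewrite -big_split /=; apply: ler_sum => c _.
  apply: le_trans (Dtri _ ((2 * x + b) %% N)%N _) _.
  by rewrite -[in X in _ <= _ + D _ X]modnDml modnMmr modnDml.
(* The leading digit of [c] is the choice made at the first step. *)
rewrite expnS (@big_cat_nat _ _ _ (2 ^ j)%N) //=; last lia.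
have -> : \sum_(2 ^ j <= c < 2 * 2 ^ j) D x ((2 * 2 ^ j * x + c) %% N)%N
    = \sum_(0 <= c < 2 ^ j) D x ((2 ^ j * (2 * x + 1) + c) %% N)%N.
  rewrite -{1}[(2 ^ j)%N]add0n big_addn mul2n -addnn addnK.
  by apply: eq_bigr => c _; congr (D x (_ %% N)%N); lia.
have -> : \sum_(0 <= c < 2 ^ j) D x ((2 * 2 ^ j * x + c) %% N)%N
    = \sum_(0 <= c < 2 ^ j) D x ((2 ^ j * (2 * x + 0) + c) %% N)%N.
  by apply: eq_bigr => c _; congr (D x (_ %% N)%N); lia.
have := lerD (half 0%N) (half 1%N); rewrite addn0 => /le_trans; apply.
by rewrite natrM le_eqVlt; apply/predU1P; left; field.
Qed.

(** The inequality [D p q <= D p y + D y q] is summed over the [2 ^ k] points [y]; by minimality of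
    [p] the first sum is at most [2 * k] times the second. *)
Lemma walk_argmin_le (R : realType) (D : nat -> nat -> R) k p q :
  (forall x, D x x = 0) -> (forall x y, D x y = D y x) ->
  (forall x y z, D x z <= D x y + D y z) -> (p < 2 ^ k)%N ->
  (forall x, (x < 2 ^ k)%N -> walk D (2 ^ k) k p <= walk D (2 ^ k) k x) ->
  (2 ^ k)%:R * D p q <= (2 * k + 1)%:R * \sum_(0 <= y < 2 ^ k) D q y.
Proof.
move=> D0 Dsym Dtri pN pmin; set N := (2 ^ k)%N in pN pmin *.
have costp : \sum_(0 <= y < N) D p y <= (2 * k)%:R * \sum_(0 <= y < N) D q y.
  apply: le_trans (sum_walk_le N q k Dsym Dtri).
  (* As [N = 2 ^ k], the end [N * p + y] is [y] modulo [N]: the walks of [k] steps reach each vertex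
     exactly once. *)
  have <- : \sum_(0 <= y < N) D p ((N * p + y) %% N)%N = \sum_(0 <= y < N) D p y.
    by apply: eq_big_nat => y /andP[_ yN]; rewrite mulnC modnMDl modn_small.
  apply: le_trans (walk_ge k D0 Dtri pN) _.
  have -> : N%:R * walk D N k p = \sum_(0 <= x < N) walk D N k p.
    by rewrite big_const_nat subn0 iter_addr_0 mulr_natl.
  by apply: ler_sum_nat => x /andP[_ xN]; apply: pmin.
have -> : N%:R * D p q = \sum_(0 <= y < N) D p q.
  by rewrite big_const_nat subn0 iter_addr_0 mulr_natl.
rewrite natrD mulrDl mul1r; apply: le_trans (lerD costp (lexx _)).
by rewrite -big_split; apply: ler_sum => y _ /=; rewrite (Dsym q).
Qed.

(** * Approximation ratio of the minimizer *)

Lemma min_cost_ind (R : realType) n (d : 'I_n -> 'I_n -> R) (p : 'I_n)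
    (P : R -> Prop) :
  (forall q, P (cost d q)) -> P (min_cost d p).
Proof.
move=> PC; apply: big_ind => // x y Px Py.
by rewrite minEle; case: ifP.
Qed.

(** [inord] sends every number above [n] to 0, so distinct numbers may be at distance 0, but
    symmetry, the triangle inequality and [D x x = 0] carry over from a metric [d] to all of
    [nat]. *)
Definition nat_metric (R : realType) n (d : 'I_n.+1 -> 'I_n.+1 -> R)
  (x y : nat) : R := d (inord x) (inord y).

Lemma cost_walk_argmin (R : realType) n (d : 'I_n.+1 -> 'I_n.+1 -> R) k
    (p : 'I_n.+1) (D := nat_metric d) :
  is_metric d -> (2 ^ k <= n.+1)%N -> (p < 2 ^ k)%N ->
  (forall x, (x < 2 ^ k)%N -> walk D (2 ^ k) k p <= walk D (2 ^ k) k x) ->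
  cost d p <= (n.+1%:R / (2 ^ k)%:R * (2 * k + 1)%:R + 1) * min_cost d p.
Proof.
move=> md kn pk pmin.
apply: (@min_cost_ind _ _ d p (fun c => cost d p <= _ * c)) => q.
have N0 : 0 < (2 ^ k)%:R :> R by rewrite ltr0n expn_gt0.
have [d_ge0 d_eq0 d_sym d_tri] := md.
have D0 x : D x x = 0 by apply: (d_eq0 _ _).2.
have Dsym x y : D x y = D y x by exact: d_sym.
have Dtri x y z : D x z <= D x y + D y z by exact: d_tri.
have := walk_argmin_le q D0 Dsym Dtri pk pmin.
have -> : D p q = d p q by rewrite /D /nat_metric !inord_val.
move=> near.
have sumN : \sum_(0 <= y < 2 ^ k) D q y <= cost d q.
  have -> : cost d q = \sum_(0 <= y < n.+1) D q y.
    by rewrite big_mkord; apply: eq_bigr => y _; rewrite /D /nat_metric !inord_val.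
  rewrite (big_cat_nat (leq0n _) kn) /= lerDl.
  by apply: sumr_ge0 => y _; exact: d_ge0.
have dpq : n.+1%:R * d p q
    <= n.+1%:R / (2 ^ k)%:R * (2 * k + 1)%:R * cost d q.
  rewrite -!mulrA ler_pM2l ?ltr0n // ler_pdivlMl //.
  by apply: le_trans near _; rewrite ler_wpM2l ?ler0n.
rewrite mulrDl mul1r; apply: le_trans (lerD dpq (lexx _)).
have -> : n.+1%:R * d p q = \sum_(y < n.+1) d p q.
  by rewrite sumr_const card_ord mulr_natl.
by rewrite -big_split; apply: ler_sum => y _; exact: d_tri.
Qed.

(** * The algorithm *)

(* Weakest precondition for total correctness; [Q] also sees the queries made. *)
Definition wp (R : realType) n (d : 'I_n -> 'I_n -> R) (c : prog)
    (s : nat -> nat) (m : nat -> R)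
    (Q : seq ('I_n * 'I_n) -> (nat -> nat) -> (nat -> R) -> Prop) : Prop :=
  exists t s' m', exec d c s m t s' m' /\ Q t s' m'.

Lemma wp_mono (R : realType) n (d : 'I_n -> 'I_n -> R) c s m Q Q' :
  wp d c s m Q -> (forall t s' m', Q t s' m' -> Q' t s' m') -> wp d c s m Q'.
Proof.
by move=> [t [s' [m' [h q]]]] QQ'; exists t, s', m'; split; last exact: QQ'.
Qed.

Lemma wp_seq (R : realType) n (d : 'I_n -> 'I_n -> R) c1 c2 s m Q :
  wp d c1 s m (fun t1 s1 m1 => wp d c2 s1 m1 (fun t2 => Q (t1 ++ t2))) ->
  wp d (PSeq c1 c2) s m Q.
Proof.
move=> [t1 [s1 [m1 [h1 [t2 [s2 [m2 [h2 q]]]]]]]].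
by exists (t1 ++ t2), s2, m2; split=> //; apply: exec_seq h1 h2.
Qed.

Lemma wp_assign (R : realType) n (d : 'I_n -> 'I_n -> R) x e s m Q :
  Q [::] (update s x (neval s e)) m -> wp d (PNat (NAssign x e)) s m Q.
Proof.
by move=> q; exists [::], (update s x (neval s e)), m; split=> //;
  apply/exec_nat/nexec_assign.
Qed.

Lemma wp_load (R : realType) n (d : 'I_n -> 'I_n -> R) a e s m Q :
  Q [::] s (update m (neval s a) (neval s e)%:R) -> wp d (PLoad a e) s m Q.
Proof. by move=> q; do 3 eexists; split; [exact: exec_load|]. Qed.

Lemma wp_arith (R : realType) n (d : 'I_n -> 'I_n -> R) o a b c x y z s m Q :
  neval s a = x -> neval s b = y -> neval s c = z ->
  Q [::] s (update m x (arith_op o (m y) (m z))) -> wp d (PArith o a b c) s m Q.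
Proof. by move=> <- <- <- q; do 3 eexists; split; [exact: exec_arith|]. Qed.

Lemma wp_compare (R : realType) n (d : 'I_n -> 'I_n -> R) x a b s m Q :
  Q [::] (update s x (m (neval s a) <= m (neval s b))) m ->
  wp d (PCompare x a b) s m Q.
Proof. by move=> q; do 3 eexists; split; [exact: exec_compare|]. Qed.

Lemma wp_query (R : realType) n (d : 'I_n -> 'I_n -> R) a u v (i j : 'I_n) s m Q :
  neval s u = i -> neval s v = j ->
  Q [:: (i, j)] s (update m (neval s a) (d i j)) -> wp d (PQuery a u v) s m Q.
Proof. by move=> ui vj q; do 3 eexists; split; [exact: exec_query ui vj|]. Qed.

(** Rule for a loop of exactly [k] rounds: [J i] is the invariant after [i] rounds and includes the
    queries made so far. Induction on the number of remaining rounds gives termination. *)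
Lemma wp_for (R : realType) n (d : 'I_n -> 'I_n -> R) e c k
    (J : nat -> seq ('I_n * 'I_n) -> (nat -> nat) -> (nat -> R) -> Prop) s m :
  (forall i t s m, (i < k)%N -> J i t s m ->
    neval s e <> 0%N /\ wp d c s m (fun t' => J i.+1 (t ++ t'))) ->
  (forall t s m, J k t s m -> neval s e = 0%N) ->
  J 0%N [::] s m -> wp d (PWhile e c) s m (J k).
Proof.
move=> step stop init.
suff loop j : forall i t s m, (i + j)%N = k -> J i t s m ->
    wp d (PWhile e c) s m (fun t' => J k (t ++ t')).
  exact: loop k 0%N [::] s m erefl init.
clear s m init; elim: j => [|j IH] i t s m ijk Ji.
  rewrite addn0 in ijk; rewrite -{}ijk in stop *.
  exists [::], s, m; rewrite cats0; split=> //.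
  exact: exec_while_false (stop _ _ _ Ji).
have [|ne [t1 [s1 [m1 [h1 J1]]]]] := step i t s m _ Ji; first lia.
have [|t2 [s2 [m2 [h2 J2]]]] := IH i.+1 _ _ _ _ J1; first lia.
exists (t1 ++ t2), s2, m2; rewrite catA; split=> //.
exact: exec_while_true ne h1 h2.
Qed.

Definition nmod (a b : nexp) : nexp := NSub a (NMul (NDiv a b) b).

Lemma neval_nmod s a b : neval s (nmod a b) = (neval s a %% neval s b)%N.
Proof. by rewrite /= {1}(divn_eq (neval s a) (neval s b)) addKn. Qed.

Lemma neval_add s a b : neval s (NAdd a b) = (neval s a + neval s b)%N.
Proof. by []. Qed.

Declare Scope prog_scope.
Notation "c1 ;; c2" := (PSeq c1 c2)
  (at level 90, right associativity, only parsing) : prog_scope.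
Local Open Scope prog_scope.

(** * Program blocks and their specifications *)

Definition incr (x : nat) : prog := PNat (NAssign x (NAdd (NVar x) (NConst 1))).

(* The program for [f] may overwrite every register, so [n] is kept in the
   real array, where it can be read only by comparison with a counter. *)
Definition restore_input : prog :=
  PNat (NAssign 1 (NConst 0)) ;; PNat (NAssign 2 (NConst 0)) ;;
  PWhile (NSub (NConst 1) (NVar 2))
    (incr 1 ;; PLoad (NConst 1) (NVar 1) ;; PCompare 2 (NConst 0) (NConst 1)).

Lemma wp_restore_input (R : realType) n (d : 'I_n -> 'I_n -> R) s m :
  (0 < n)%N -> m 0%N = n%:R ->
  wp d restore_input s m (fun t s' m' =>
    [/\ t = [::], s' 0%N = s 0%N, s' 1%N = n
      & forall a, (1 < a)%N -> m' a = m a]).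
Proof.
move=> n0 m0; apply/wp_seq/wp_assign/wp_seq/wp_assign.
pose J i t s' (m' : nat -> R) :=
  [/\ t = [::] :> seq ('I_n * 'I_n), s' 0%N = s 0%N, s' 1%N = i,
     s' 2%N = (n <= i)%N & m' 0%N = n%:R /\ forall a, (1 < a)%N -> m' a = m a].
apply: (wp_mono (wp_for (k := n) (J := J) _ _ _)).
- move=> i t s1 m1 i_n [-> s0 s1i s2 [m10 m1a]]; split.
    by rewrite /= s2 leqNgt i_n.
  apply/wp_seq/wp_assign/wp_seq/wp_load/wp_compare; split=> //=.
  - by rewrite /update /= s1i addn1.
  - by rewrite /update /= m10 s1i addn1 ler_nat.
  - by split=> // -[|[|a]] // _; rewrite -m1a.
- by move=> t s1 m1 [_ _ _ s2 _]; rewrite /= s2 leqnn.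
(* The flag starts at 0, the truth value of [n <= 0] for positive [n]. *)
- by split=> //=; rewrite /update /= leqn0 eqn0Ngt n0.
- by move=> t s1 m1 [-> -> -> _ [_ ma]].
Qed.

(* [2 ^ k] is the largest power of two with [2 ^ k <= n / sqrt F], or [k = 0]. *)
Definition sample_level (n F k : nat) : Prop :=
  (n * n < 4 * (2 ^ k * 2 ^ k) * F)%N /\
  forall i, (i < k)%N -> (4 * (2 ^ i * 2 ^ i) * F <= n * n)%N.

(** Squaring avoids the root: [N] is doubled while [4 * N ^ 2 * F <= n ^ 2], and the added 1 turns
    truncated subtraction into this non-strict test. *)
Definition choose_level : prog :=
  PNat (NAssign 2 (NConst 1)) ;; PNat (NAssign 3 (NConst 0)) ;;
  PWhile (NSub (NAdd (NMul (NVar 1) (NVar 1)) (NConst 1))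
               (NMul (NMul (NConst 4) (NMul (NVar 2) (NVar 2))) (NVar 0)))
    (PNat (NAssign 2 (NMul (NConst 2) (NVar 2))) ;; incr 3).

Lemma wp_choose_level (R : realType) n (d : 'I_n -> 'I_n -> R) s m k :
  sample_level (s 1%N) (s 0%N) k ->
  wp d choose_level s m (fun t s' m' =>
    [/\ t = [::], s' 2%N = (2 ^ k)%N, s' 3%N = k & m' = m]).
Proof.
move=> [kbig ksmall]; apply/wp_seq/wp_assign/wp_seq/wp_assign.
pose J i t s' (m' : nat -> R) :=
  [/\ t = [::] :> seq ('I_n * 'I_n), s' 0%N = s 0%N, s' 1%N = s 1%N,
     s' 2%N = (2 ^ i)%N & s' 3%N = i /\ m' = m].
apply: (wp_mono (wp_for (k := k) (J := J) _ _ _)).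
- move=> i t s1 m1 ik [-> e0 e1 e2 [e3 ->]]; split.
    by rewrite /= e0 e1 e2; have := ksmall i ik; lia.
  apply/wp_seq/wp_assign/wp_assign; split=> //=.
  - by rewrite /update /= e2 expnS.
  - by rewrite /update /= e3 addn1.
- move=> t s1 m1 [_ e0 e1 e2 _]; rewrite /= e0 e1 e2.
  by apply/eqP; rewrite subn_eq0 addn1.
- by [].
- by move=> t s1 m1 [-> _ _ -> [-> ->]].
Qed.

Definition edges (N : nat) n (x : nat) : seq ('I_n.+1 * 'I_n.+1) :=
  [:: (inord x, inord ((2 * x) %% N)); (inord x, inord ((2 * x + 1) %% N))].

(** The list depends on no distance; this yields nonadaptivity and the query count. *)
Definition query_trace (N n i : nat) : seq ('I_n.+1 * 'I_n.+1) :=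
  flatten [seq edges N n x | x <- iota 0 i].

Lemma query_traceS N n i :
  query_trace N n i.+1 = query_trace N n i ++ edges N n i.
Proof.
have iotaS : iota 0 i.+1 = iota 0 i ++ [:: i] by rewrite -addn1 iotaD.
by rewrite /query_trace iotaS map_cat flatten_cat.
Qed.

Lemma size_query_trace N n i : size (query_trace N n i) = (2 * i)%N.
Proof.
by elim: i => [//|i IH]; rewrite query_traceS size_cat IH mulnS addnC.
Qed.

(* Successors of the vertex [x] in the graph whose order is in register 2. *)
Definition succ0 (x : nexp) : nexp := nmod (NMul (NConst 2) x) (NVar 2).
Definition succ1 (x : nexp) : nexp :=
  nmod (NAdd (NMul (NConst 2) x) (NConst 1)) (NVar 2).

Lemma neval_succ0 s x : neval s (succ0 x) = ((2 * neval s x) %% s 2)%N.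
Proof. by rewrite neval_nmod. Qed.

Lemma neval_succ1 s x : neval s (succ1 x) = ((2 * neval s x + 1) %% s 2)%N.
Proof. by rewrite neval_nmod. Qed.

(** Address 1 is scratch. The addresses from [N + 2] on stay untouched, so that the next phase finds
    zeros there. *)
Definition query_edges : prog :=
  PNat (NAssign 4 (NConst 0)) ;;
  PWhile (NSub (NVar 2) (NVar 4))
    (PQuery (NAdd (NConst 2) (NVar 4)) (NVar 4) (succ0 (NVar 4)) ;;
     PQuery (NConst 1) (NVar 4) (succ1 (NVar 4)) ;;
     PArith AAdd (NAdd (NConst 2) (NVar 4))
       (NAdd (NConst 2) (NVar 4)) (NConst 1) ;;
     incr 4).

Lemma wp_query_edges (R : realType) n (d : 'I_n.+1 -> 'I_n.+1 -> R) s m N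
    (D := nat_metric d) :
  s 2%N = N -> (N <= n.+1)%N ->
  wp d query_edges s m (fun t s' m' =>
    [/\ t = query_trace N n N, s' 2%N = s 2%N, s' 3%N = s 3%N,
        forall x, (x < N)%N ->
          m' (2 + x)%N = D x ((2 * x) %% N)%N + D x ((2 * x + 1) %% N)%N
      & forall a, (N + 2 <= a)%N -> m' a = m a]).
Proof.
move=> sN Nn; apply/wp_seq/wp_assign.
pose J i t s' m' :=
  [/\ t = query_trace N n i, s' 2%N = s 2%N /\ s' 3%N = s 3%N, s' 4%N = i,
     forall x, (x < i)%N ->
       m' (2 + x)%N = D x ((2 * x) %% N)%N + D x ((2 * x + 1) %% N)%N
   & forall a, (N + 2 <= a)%N -> m' a = m a].
apply: (wp_mono (wp_for (k := N) (J := J) _ _ _)).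
- move=> i t s1 m1 iN [-> [e2 e3] e4 mE ma]; rewrite sN in e2; split.
    by rewrite /= e2 e4; lia.
  have modN z : (z %% N < n.+1)%N by apply: leq_trans Nn; rewrite ltn_mod; lia.
  apply/wp_seq/(wp_query (i := inord i) (j := inord ((2 * i) %% N))).
  + by rewrite /= e4 inordK // (leq_trans iN).
  + by rewrite neval_succ0 /= e2 e4 inordK.
  apply/wp_seq/(wp_query (i := inord i) (j := inord ((2 * i + 1) %% N))).
  + by rewrite /= e4 inordK // (leq_trans iN).
  + by rewrite neval_succ1 /= e2 e4 inordK.
  apply/wp_seq/(@wp_arith _ _ _ _ _ _ _ (2 + i)%N (2 + i)%N 1%N);
    rewrite ?/= ?e4 //.
  apply/wp_assign; split.
  + by rewrite query_traceS.
  + by rewrite /update /= e2 sN.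
  + by rewrite /update /= e4 addn1.
  + move=> x xi; rewrite /update /=.
    have [->|xne] := eqVneq x i; first by rewrite !eqxx.
    have -> : (2 + x == 2 + i)%N = false by lia.
    by rewrite mE //; lia.
  + move=> a aN; rewrite /update /= ?e4.
    have -> : (a == 2 + i)%N = false by lia.
    by have -> : (a == 1)%N = false by [lia]; rewrite ma.
- by move=> t s1 m1 [_ [e2 _] e4 _ _]; rewrite /= e2 e4 sN subnn.
- by [].
- by move=> t s1 m1 [-> [-> ->] _ mE ma].
Qed.

(* The lengths of the edges are at the addresses [2 + x] with [x < N]; the
   value [walk D N j x] is stored at the address [2 + N + (j * N + x)]. *)
Definition average_walks : prog :=
  PLoad (NConst 0) (NConst 2) ;; PNat (NAssign 4 (NConst 0)) ;;
  PWhile (NSub (NMul (NVar 3) (NVar 2)) (NVar 4))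
    (PNat (NAssign 5 (nmod (NVar 4) (NVar 2))) ;;
     PNat (NAssign 6
       (NAdd (NAdd (NConst 2) (NVar 2)) (NMul (NDiv (NVar 4) (NVar 2)) (NVar 2)))) ;;
     PArith AAdd (NConst 1) (NAdd (NConst 2) (NVar 5))
       (NAdd (NVar 6) (succ0 (NVar 5))) ;;
     PArith AAdd (NConst 1) (NConst 1) (NAdd (NVar 6) (succ1 (NVar 5))) ;;
     PArith ADiv (NAdd (NAdd (NConst 2) (NVar 2)) (NAdd (NVar 2) (NVar 4)))
       (NConst 1) (NConst 0) ;;
     incr 4).

(** The table is filled row by row: round [i] writes the flat index [N + i], that is row
    [i %/ N + 1] and column [i %% N], from row [i %/ N], which is already complete. *)
Lemma wp_average_walks (R : realType) n (d : 'I_n -> 'I_n -> R) s m N k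
    (D : nat -> nat -> R) :
  s 2%N = N -> s 3%N = k -> (0 < N)%N ->
  (forall x, (x < N)%N ->
     m (2 + x)%N = D x ((2 * x) %% N)%N + D x ((2 * x + 1) %% N)%N) ->
  (forall a, (N + 2 <= a)%N -> m a = 0) ->
  wp d average_walks s m (fun t s' m' =>
    [/\ t = [::], s' 2%N = N, s' 3%N = k
      & forall x, (x < N)%N -> m' (2 + N + (k * N + x))%N = walk D N k x]).
Proof.
move=> sN sk N0 mE m0; apply/wp_seq/wp_load/wp_seq/wp_assign.
pose J i t s' m' :=
  [/\ t = [::] :> seq ('I_n * 'I_n), s' 2%N = N /\ s' 3%N = k, s' 4%N = i,
     m' 0%N = 2%:R :> R /\ (forall x, (x < N)%N ->
       m' (2 + x)%N = D x ((2 * x) %% N)%N + D x ((2 * x + 1) %% N)%N)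
   & forall b, (b < N + i)%N -> m' (2 + N + b)%N = walk D N (b %/ N) (b %% N)].
apply: (wp_mono (wp_for (k := (k * N)%N) (J := J) _ _ _)).
- move=> i t s1 m1 iN [-> [e2 e3] e4 [m2 m1E] mW]; split.
    by rewrite /= e2 e3 e4; lia.
  have modN z : (z %% N < N)%N by rewrite ltn_mod.
  have row z : (z < N)%N -> (i %/ N * N + z < N + i)%N.
    by move=> zN; have := leq_trunc_div i N; lia.
  have Wz z : (z < N)%N -> m1 (2 + N + i %/ N * N + z)%N = walk D N (i %/ N) z.
    move=> zN; rewrite -addnA mW ?row //.
    by rewrite divnMDl // (divn_small zN) addn0 modnMDl modn_small.
  apply/wp_seq/wp_assign/wp_seq/wp_assign; rewrite neval_nmod.
  pose x := (i %% N)%N; pose r := (2 + N + i %/ N * N)%N.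
  pose x0 := ((2 * x) %% N)%N; pose x1 := ((2 * x + 1) %% N)%N.
  apply/wp_seq/(@wp_arith _ _ _ _ _ _ _ 1%N (2 + x)%N (r + x0)%N) => //.
  + by rewrite /= /update /= e2 e4.
  + by rewrite neval_add neval_succ0 /= /update /= e2 e4.
  apply/wp_seq/(@wp_arith _ _ _ _ _ _ _ 1%N 1%N (r + x1)%N) => //.
  + by rewrite neval_add neval_succ1 /= /update /= e2 e4.
  apply/wp_seq/(@wp_arith _ _ _ _ _ _ _ (2 + N + (N + i))%N 1%N 0%N) => //.
  + by rewrite /= /update /= e2 e4.
  apply/wp_assign.
  split=> //=.
  + by rewrite /update /= e4 addn1.
  + split=> [//|y yN]; rewrite ?add2n /update /=.
    have -> : (y.+2 == 2 + N + (N + i))%N = false by lia.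
    by rewrite -m1E.
  + move=> b bi; rewrite /update /=.
    have [->|bne] := eqVneq b (N + i)%N.
      rewrite eqxx m1E ?modN // /r !Wz ?modN // m2.
      by rewrite divnDl ?dvdnn // divnn N0 modnDl add1n.
    have -> : (2 + N + b == 2 + N + (N + i))%N = false by lia.
    by rewrite mW //; lia.
- by move=> t s1 m1 [_ [e2 e3] e4 _ _]; rewrite /= e2 e3 e4 subnn.
(* Row 0 holds the walks of no steps, whose length 0 is already in the array. *)
- split=> //= b; rewrite addn0 => bN; rewrite /update /=.
  by rewrite divn_small //= m0 //; lia.
- move=> t s1 m1 [-> [-> ->] _ _ mW]; split=> // x xN.
  by rewrite mW ?divnMDl // ?(divn_small xN) ?addn0 ?modnMDl ?modn_small //; lia.
Qed.

(** The branch is arithmetic: with the comparison flag [t] in register 5, register 0 becomes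
    [t * x + (1 - t) * p]. *)
Definition select_min : prog :=
  PNat (NAssign 0 (NConst 0)) ;; PNat (NAssign 4 (NConst 0)) ;;
  PNat (NAssign 6 (NAdd (NAdd (NConst 2) (NVar 2)) (NMul (NVar 3) (NVar 2)))) ;;
  PWhile (NSub (NVar 2) (NVar 4))
    (PCompare 5 (NAdd (NVar 6) (NVar 4)) (NAdd (NVar 6) (NVar 0)) ;;
     PNat (NAssign 0 (NAdd (NMul (NVar 5) (NVar 4))
                           (NMul (NSub (NConst 1) (NVar 5)) (NVar 0)))) ;;
     incr 4).

Lemma wp_select_min (R : realType) n (d : 'I_n -> 'I_n -> R) s m N k
    (W : nat -> R) :
  s 2%N = N -> s 3%N = k -> (0 < N)%N ->
  (forall x, (x < N)%N -> m (2 + N + (k * N + x))%N = W x) ->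
  wp d select_min s m (fun t s' m' =>
    [/\ t = [::], (s' 0 < N)%N & forall x, (x < N)%N -> W (s' 0%N) <= W x]).
Proof.
move=> sN sk N0 mW; apply/wp_seq/wp_assign/wp_seq/wp_assign/wp_seq/wp_assign.
pose J i t s' m' :=
  [/\ t = [::] :> seq ('I_n * 'I_n), s' 2%N = N /\ s' 6%N = (2 + N + k * N)%N,
     s' 4%N = i /\ m' = m, (s' 0 < N)%N
   & forall x, (x < i)%N -> W (s' 0%N) <= W x].
apply: (wp_mono (wp_for (k := N) (J := J) _ _ _)).
- move=> i t s1 m1 iN [-> [e2 e6] [e4 ->] e0 Wle]; split.
    by rewrite /= e2 e4; lia.
  apply/wp_seq/wp_compare/wp_seq/wp_assign/wp_assign.
  rewrite /= e4 e6 -!addnA !addnA -2![(2 + N + k * N + _)%N]addnA !mW //.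
  have [le|lt] := leP (W i) (W (s1 0%N)); split=> //=;
    rewrite /update /= ?e4 ?addn1 ?mul1n ?mul0n ?addn0 //.
  + move=> x; rewrite ltnS leq_eqVlt => /predU1P[->//|xi].
    exact: le_trans le (Wle _ xi).
  + move=> x; rewrite ltnS leq_eqVlt => /predU1P[->|/Wle//].
    exact: ltW.
- by move=> t s1 m1 [_ [e2 _] [e4 _] _ _]; rewrite /= e2 e4 subnn.
- by split=> //=; rewrite /update /= ?sN ?sk.
- by move=> t s1 m1 [-> _ _ ? ?].
Qed.

(* From [choose_level] on, register 2 contains [2 ^ k] and register 3
   contains [k]. *)
Definition median_prog (c : nprog) : prog :=
  PLoad (NConst 0) (NVar 0) ;; PNat c ;; restore_input ;; choose_level ;;
  query_edges ;; average_walks ;; select_min.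

(** * The sample level and the run of the whole program *)

Lemma sample_level_exists n F : (0 < F)%N -> exists k, sample_level n F k.
Proof.
move=> F0; pose big k := (n * n < 4 * (2 ^ k * 2 ^ k) * F)%N.
have ex_big : exists k, big k.
  (* [k = n] qualifies, since [2 ^ n > n] and [F > 0]. *)
  by exists n; rewrite /big; have := ltn_expl n (isT : (1 < 2)%N); nia.
case: (ex_minnP ex_big) => k kbig kmin; exists k; split=> // i ik.
by rewrite leqNgt; apply/negP => /kmin; rewrite leqNgt ik.
Qed.

(** Minimality of [k], applied at [k - 1]. For [k = 0] the inequality fails when [F > n ^ 2]. *)
Lemma sample_level_gt0 n F k : (0 < k)%N -> sample_level n F k ->
  (2 ^ k * 2 ^ k * F <= n * n)%N.
Proof.
case: k => // k _ [_ /(_ k (ltnSn k))]; rewrite expnS.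
by apply: leq_trans; apply/eq_leq; ring.
Qed.

Lemma sample_level_le n F k : (0 < n)%N -> (0 < F)%N -> sample_level n F k ->
  (2 ^ k <= n)%N.
Proof.
case: k => // k n0 F0 /(sample_level_gt0 (ltn0Sn k)) le.
rewrite -leq_sqr -!mulnn; apply: leq_trans le.
by rewrite leq_pmulr.
Qed.

Lemma median_prog_outputs (R : realType) n (d : 'I_n.+1 -> 'I_n.+1 -> R) c s k :
  nexec c (input n.+1) s -> sample_level n.+1 (s 0%N) k -> (2 ^ k <= n.+1)%N ->
  exists2 p : 'I_n.+1, outputs (median_prog c) d (query_trace (2 ^ k) n (2 ^ k)) p &
    (p < 2 ^ k)%N /\ forall x, (x < 2 ^ k)%N ->
      walk (nat_metric d) (2 ^ k) k p <= walk (nat_metric d) (2 ^ k) k x.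
Proof.
move=> hc lev kn; have N0 : (0 < 2 ^ k)%N by rewrite expn_gt0.
suff [t [s' [m' [ex [te pN pmin]]]]] : wp d (median_prog c) (input n.+1) (fun=> 0)
    (fun t s' _ => [/\ t = query_trace (2 ^ k) n (2 ^ k), (s' 0 < 2 ^ k)%N
      & forall x, (x < 2 ^ k)%N -> walk (nat_metric d) (2 ^ k) k (s' 0%N)
          <= walk (nat_metric d) (2 ^ k) k x]).
  have pK : (inord (s' 0%N) : 'I_n.+1) = s' 0%N :> nat.
    by rewrite inordK // (leq_trans pN).
  exists (inord (s' 0%N)); last by rewrite pK.
  by exists s', m'; rewrite -te pK.
apply/wp_seq/wp_load/wp_seq.
exists [::], s; eexists; split; first exact: exec_nat hc.
apply: wp_seq; apply: wp_mono (wp_restore_input _ _ _ _) _ => //.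
move=> t1 s1 m1 [-> e0 e1 m1E].
apply: wp_seq; apply: wp_mono (wp_choose_level _ _ _) _; first by rewrite e0 e1; exact: lev.
move=> t2 s2 m2 [-> e2 e3 ->].
apply: wp_seq; apply: wp_mono (wp_query_edges _ _ e2 kn) _.
move=> t3 s3 m3 [-> e23 e33 m3E m30].
rewrite {}e2 in e23; rewrite {}e3 in e33.
apply: wp_seq; apply: wp_mono (wp_average_walks _ e23 e33 N0 m3E _) _.
  move=> a aN; rewrite m30 // m1E; last lia.
  by rewrite /update /=; case: eqP => //; lia.
move=> t4 s4 m4 [-> e24 e34 mW].
apply: wp_mono (wp_select_min _ e24 e34 N0 mW) _.
by move=> t5 s5 m5 [-> pN pmin]; rewrite !cats0.
Qed.

(** * Asymptotics *)

Definition median_ratio (R : realType) (k : nat -> nat) (n : nat) : R :=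
  n%:R / (2 ^ k n)%:R * (2 * k n + 1)%:R + 1.

Lemma near_ge_of_omega (R : realType) (f : nat -> nat) (a : R) :
  (fun _ : nat => 1 : R^o) =o_\oo (fun n : nat => (f n)%:R : R^o) ->
  0 < a -> \forall n \near \oo, a <= (f n)%:R.
Proof.
move=> /eqoP f_omega a0.
have : 0 < a^-1 by rewrite invr_gt0.
move=> /f_omega; apply: filterS => n /=.
by rewrite normr1 [`|_|]ger0_norm ?ler0n // ler_pdivlMl // mulr1.
Qed.

(** For [k n > 0], [(2N) ^ 2 <= 4 * n ^ 2 / F <= (e * n) ^ 2] once [F >= 4 / e ^ 2]; for [k n = 0]
    the count is 2, which is at most [e * n] once [n >= 2 / e]. *)
Lemma query_count_littleo (R : realType) (f k : nat -> nat) :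
  (fun _ : nat => 1 : R^o) =o_\oo (fun n : nat => (f n)%:R : R^o) ->
  (forall n, (0 < n)%N -> sample_level n (f n) (k n)) ->
  (fun n : nat => (2 * 2 ^ k n)%:R : R^o) =o_\oo (fun n : nat => n%:R : R^o).
Proof.
move=> f_omega lev; apply/eqoP => e e0.
near=> n; rewrite [`|_ : R^o|]ger0_norm ?ler0n // [`|_ : R^o|]ger0_norm ?ler0n //.
have n0 : (0 < n)%N by near: n; exact: nbhs_infty_gt.
have fe : 4 / e ^+ 2 <= (f n)%:R.
  by near: n; apply: near_ge_of_omega f_omega _; rewrite divr_gt0 ?exprn_gt0.
have ne : 2 / e <= n%:R by near: n; exact: nbhs_infty_ger.
rewrite ler_pdivrMr // mulrC in ne.
case: (posnP (k n)) => [->|k0]; first by rewrite expn0 muln1.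
have := sample_level_gt0 k0 (lev n n0).
rewrite -(ler_nat R) !natrM; set N := (2 ^ k n)%:R; set F := (f n)%:R in fe *.
rewrite ler_pdivrMr ?exprn_gt0 // in fe.
move=> NF; have N0 : 0 <= N by rewrite ler0n.
rewrite -ler_sqr ?nnegrE ?mulr_ge0 ?ler0n ?(ltW e0) //.
have : 4 * N ^+ 2 <= F * e ^+ 2 * N ^+ 2 by rewrite ler_wpM2r ?exprn_ge0.
have : N * N * F * e ^+ 2 <= n%:R * n%:R * e ^+ 2 by rewrite ler_wpM2r ?exprn_ge0 ?(ltW e0).
rewrite !exprMn !expr2; lra.
Unshelve. all: by end_near.
Qed.

(** Maximality of [N] gives [n / N < 2 * sqrt F], which is at most [dl * F] once [F >= 4 / dl ^ 2],
    while [2 ^ k <= n] gives [2 * k + 1 = O(ln n)]. *)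
Lemma median_ratio_littleo (R : realType) (f k : nat -> nat) :
  (fun _ : nat => 1 : R^o) =o_\oo (fun n : nat => (f n)%:R : R^o) ->
  (forall n, (0 < n)%N -> (0 < f n)%N) ->
  (forall n, (0 < n)%N -> sample_level n (f n) (k n)) ->
  (fun n : nat => median_ratio R k n : R^o)
    =o_\oo (fun n : nat => (f n)%:R * ln (n%:R : R) : R^o).
Proof.
move=> f_omega f_pos lev; apply/eqoP => e e0.
have ln2 : 0 < ln (2%:R : R) by rewrite ln_gt0 ?ltr1n.
(* [2 * k] is at most [2 / ln 2] times [ln n], and 1 is at most [ln n] for large [n]. *)
pose C : R := 2 / ln (2%:R : R) + 1.
have C0 : 0 < C by apply: addr_gt0 => //; apply: divr_gt0.
(* [e] splits into [dl * C] for the main term and [dl] for the added 1. *)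
have [dl dl0 edl] : exists2 dl, 0 < dl & e = dl * (C + 1).
  exists (e / (C + 1)); first by apply: divr_gt0 => //; apply: addr_gt0.
  by rewrite divfK // lt0r_neq0 // addr_gt0.
near=> n.
have n0 : (0 < n)%N by near: n; exact: nbhs_infty_gt.
have nR0 : 0 < n%:R :> R by rewrite ltr0n.
have ln1 : 1 <= ln (n%:R : R).
  rewrite -[leLHS]expRK ler_ln ?posrE ?expR_gt0 //.
  by near: n; exact: nbhs_infty_ger.
have f1 : dl^-1 <= (f n)%:R.
  by near: n; apply: near_ge_of_omega f_omega _; rewrite invr_gt0.
have f2 : 4 / dl ^+ 2 <= (f n)%:R.
  by near: n; apply: near_ge_of_omega f_omega _; rewrite divr_gt0 ?exprn_gt0.
have [big _] := lev n n0.
have le2n := sample_level_le n0 (f_pos n n0) (lev n n0).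
set F : R := (f n)%:R in f1 f2 *.
set N : R := (2 ^ k n)%:R.
have N0 : 0 < N by rewrite ltr0n expn_gt0.
have F0 : 0 < F by rewrite ltr0n f_pos.
have kln : (2 * k n + 1)%:R <= C * ln (n%:R : R).
  have : (k n)%:R * ln (2%:R : R) <= ln (n%:R : R).
    rewrite mulr_natl -lnXn ?ltr0n // ler_ln ?posrE ?exprn_gt0 ?ltr0n //.
    by rewrite -natrX ler_nat.
  rewrite -ler_pdivlMr // => kle.
  rewrite /C [leRHS]mulrDl mul1r natrD natrM lerD //.
  by rewrite -!mulrA [_^-1 * _]mulrC ler_pM2l.
have snF : n%:R / N <= dl * F.
  rewrite ler_pdivrMr // -ler_sqr ?nnegrE ?mulr_ge0 ?ler0n ?(ltW dl0) //.
  move: big; rewrite -(ltr_nat R) !natrM -/N -/F => big.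
  rewrite ler_pdivrMr ?exprn_gt0 // in f2.
  have : 4 * (N ^+ 2 * F) <= F * dl ^+ 2 * (N ^+ 2 * F).
    by rewrite ler_wpM2r ?mulr_ge0 ?exprn_ge0 ?ler0n.
  rewrite !exprMn !expr2; lra.
have g_ge0 : 0 <= median_ratio R k n.
  by rewrite addr_ge0 ?mulr_ge0 ?invr_ge0 ?ler0n.
rewrite ger0_norm // ger0_norm; last by rewrite mulr_ge0 ?ler0n ?ln_ge0 ?ler1n.
rewrite /median_ratio -/N -/F.
have -> : e * (F * ln (n%:R : R))
    = dl * F * (C * ln (n%:R : R)) + dl * F * ln (n%:R : R).
  by rewrite edl; ring.
apply: lerD.
  by apply: ler_pM => //; rewrite ?divr_ge0 ?ler0n.
(* The added 1 is written [1 * 1], against [1 <= dl * F] and [1 <= ln n]. *)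
rewrite -[leLHS]mulr1; apply: ler_pM => //.
by rewrite -ler_pdivrMl ?mulr1.
Unshelve. all: by end_near.
Qed.

(** All inputs of one size have the same query count, so one metric for each number of points shows
    that the maximum is attained. *)
Lemma discrete_is_metric (R : realType) (T : eqType) :
  is_metric (fun x y : T => (x != y)%:R : R).
Proof.
split=> [x y|x y|x y|x y z]; first exact: ler0n.
- by split=> [/eqP|->]; rewrite ?eqxx // pnatr_eq0 eqb0 negbK => /eqP.
- by rewrite eq_sym.
- have [->|xy] := eqVneq x y; first by rewrite add0r.
  by rewrite -natrD ler_nat; case: (x != z).
Qed.

Theorem theorem7 (R : realType) (f : nat -> nat)
    (f_pos : forall n, (0 < n)%N -> (0 < f n)%N)
    (f_computable : computable f)
    (f_omega : (fun _ : nat => 1 : R^o) =o_\oo (fun n : nat => (f n)%:R : R^o)) :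
  exists A : prog,
    [/\ median_algorithm R A,
        nonadaptive R A,
        exists q : nat -> nat, query_complexity R A q /\
          (fun n : nat => (q n)%:R : R^o) =o_\oo (fun n : nat => n%:R : R^o)
      & exists g : nat -> R, approximate A g /\
          (fun n : nat => g n : R^o) =o_\oo
            (fun n : nat => (f n)%:R * ln (n%:R : R) : R^o)].
Proof.
have [c cP] := f_computable; exists (median_prog c).
have /choice[k kP] n : exists k, (0 < n)%N -> sample_level n (f n) k.
  have [->|n0] := posnP n; first by exists 0%N.
  by have [k kP] := sample_level_exists n (f_pos n n0); exists k.
(* One run serves all four claims: by determinism every output on [d] is this one. *)
have runs n (d : 'I_n.+1 -> 'I_n.+1 -> R) :
    exists2 p : 'I_n.+1,
      outputs (median_prog c) d (query_trace (2 ^ k n.+1) n (2 ^ k n.+1)) p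
    & is_metric d -> cost d p <= median_ratio R k n.+1 * min_cost d p.
  have [s cs sf] := cP n.+1 isT.
  have lev := kP n.+1 isT; have len := sample_level_le (ltn0Sn n) (f_pos n.+1 isT) lev.
  rewrite -sf in lev; have [p out [pN pmin]] := median_prog_outputs d cs lev len.
  by exists p => // md; apply: cost_walk_argmin.
split.
- move=> [|n] d // _ _; have [p out _] := runs n d.
  by exists (query_trace (2 ^ k n.+1) n (2 ^ k n.+1)), p.
- move=> [|n] d d' t t' p p'; first by case: p.
  move=> _ _ out out'; have [r o _] := runs n d; have [r' o' _] := runs n d'.
  by have [-> _] := outputs_det out o; have [-> _] := outputs_det out' o'.
- exists (fun n => 2 * 2 ^ k n)%N; split; last exact: query_count_littleo f_omega kP.
  move=> [|n] // _; split=> [d t p _ out|].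
    have [r o _] := runs n d; have [-> _] := outputs_det out o.
    by rewrite size_query_trace.
  pose d (x y : 'I_n.+1) : R := (x != y)%:R; have [p out _] := runs n d.
  exists d, (query_trace (2 ^ k n.+1) n (2 ^ k n.+1)), p.
  by split; [exact: discrete_is_metric| |exact: size_query_trace].
- exists (median_ratio R k); split; last exact: median_ratio_littleo.
  move=> [|n] d t p // _ md out; have [r o app] := runs n d.
  by have [_ ->] := outputs_det out o; exact: app.
Qed.
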